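(* Let $d\ge 1$ and let $f(t,x)$, $t\ge 0$, $x\in\mathbb{Z}^d$, be the surface height of the RSOS model on $\mathbb{Z}^d$ started from the all-zero initial configuration and driven by independent rate-$1$ Poisson clocks. Then for all $t \ge 0$ and all $x\in\mathbb{Z}^d$, $$\operatorname{Var}(f(t,x)) \le t .$$
   Context: RSOS (Restricted Solid-on-Solid) model: let $\mathcal{N}=\{\pm e_i\}_{i=1}^d$ be the nearest neighbours of the origin in $\mathbb{Z}^d$. Independent rate-$1$ Poisson clocks are attached to the sites of $\mathbb{Z}^d$; their rings form a Poisson point process $\mathcal{U}$ on $\mathbb{R}_+\times\mathbb{Z}^d$ (intensity: sum of the Lebesgue measures on the copies of $\mathbb{R}_+$). The height $f:\mathbb{R}_+\times\mathbb{Z}^d\to\mathbb{Z}$ is right-continuous in time; the height at $x$ can only change when the clock at $x$ rings, and when the clock at $x$ rings at time $t$, $$f(t,x)=f(t^-,x)+\prod_{n\in\mathcal{N}}\mathbf{1}\{f(t^-,x)\le f(t^-,x+n)\},$$ where $t^-$ denotes the left limit in time. The process is almost surely well defined. All-zero initial configuration means $f(0,x)=0$ for all $x$. *)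

(* Defs.v *)
From mathcomp Require Import all_boot all_order all_algebra.
From mathcomp Require Import all_classical all_reals all_analysis.
From mathcomp Require Import measurable_realfun.
Import Order.TTheory GRing.Theory Num.Theory.
Import numFieldNormedType.Exports.

Set Implicit Arguments.
Unset Strict Implicit.
Unset Printing Implicit Defensive.

Local Open Scope classical_set_scope.
Local Open Scope ring_scope.

(* Taking B i = setT for some i gives the product rule for subfamilies. *)
Definition mutually_independent (disp : measure_display)
    (Omega : measurableType disp) (R : realType) (P : probability Omega R)
    (n : nat) (X : 'I_n -> Omega -> \bar R) : Prop :=
  forall B : 'I_n -> set (\bar R), (forall i, measurable (B i)) ->
    P (\bigcap_i (X i @^-1` B i)) = (\prod_(i < n) P (X i @^-1` B i))%E.

(* Borel subsets of R_+ x Z^d.  As Z^d is countable and discrete, a set is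
   Borel iff its section over each site is. *)
Definition spacetime_measurable (R : realType) (d : nat)
    (A : set (R * 'rV[int]_d)) : Prop :=
  A `<=` [set p | 0 <= p.1] /\ forall x, measurable (ysection A x).

Definition spacetime_intensity (R : realType) (d : nat)
    (A : set (R * 'rV[int]_d)) : \bar R :=
  \esum_(x in [set: 'rV[int]_d]) lebesgue_measure (ysection A x).

Definition point_count (R : realType) (d : nat) (Omega : Type)
    (U : Omega -> set (R * 'rV[int]_d)) (A : set (R * 'rV[int]_d))
    (w : Omega) : \bar R :=
  counting (A `&` U w).

(* The intensity measure has no atoms, so the process has no multiple points
   and a random set of points represents it.
   [poisson_prob] is used rather than [poisson_pmf], which is not a pmf at
   rate 0; the second argument of [poisson_prob] is unused. *)
Record poisson_point_process (disp : measure_display)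
    (Omega : measurableType disp) (R : realType) (P : probability Omega R)
    (d : nat) (U : Omega -> set (R * 'rV[int]_d)) : Prop := {
  ppp_subset : forall w, U w `<=` [set p | 0 <= p.1] ;
  ppp_measurable : forall A, spacetime_measurable A ->
    measurable_fun setT (point_count U A) ;
  ppp_law : forall A, spacetime_measurable A ->
    (spacetime_intensity A < +oo)%E -> forall k : nat,
    P [set w | point_count U A w = k%:R%:E] =
      poisson_prob (fine (spacetime_intensity A)) 0%N [set k] ;
  ppp_independent : forall (n : nat) (A : 'I_n -> set (R * 'rV[int]_d)),
    (forall i, spacetime_measurable (A i)) -> trivIset setT A ->
    mutually_independent P (fun i => point_count U (A i))
}.

Definition neighbours (d : nat) : seq 'rV[int]_d :=
  [seq s *: delta_mx 0 i | s <- [:: 1; -1], i <- enum 'I_d].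

(* Convergence in the discrete space of integers is eventual equality. *)
Definition is_left_limit (R : realType) (d : nat)
    (f : R -> 'rV[int]_d -> int) (t : R) (x : 'rV[int]_d) (h : int) : Prop :=
  \forall s \near t^'-, f s x = h.

Definition left_limit (R : realType) (d : nat)
    (f : R -> 'rV[int]_d -> int) (t : R) (x : 'rV[int]_d) : int :=
  xget 0 [set h | is_left_limit f t x h].

(* [U] is the set of pairs (t, x) such that the clock at x rings at time t;
   values of [f] at negative times are irrelevant. *)
Record rsos_path (R : realType) (d : nat) (U : set (R * 'rV[int]_d))
    (f0 : 'rV[int]_d -> int) (f : R -> 'rV[int]_d -> int) : Prop := {
  rsos_init : forall x, f 0 x = f0 x ;
  rsos_right_continuous : forall (t : R) (x : 'rV[int]_d), 0 <= t ->
    \forall s \near t^'+, f s x = f t x ;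
  rsos_left_limit : forall (t : R) (x : 'rV[int]_d), 0 < t -> exists h, is_left_limit f t x h ;
  rsos_constant : forall (s t : R) (x : 'rV[int]_d), 0 <= s -> s <= t ->
    (forall r : R, s < r -> r <= t -> ~ U (r, x)) -> f t x = f s x ;
  rsos_update : forall (t : R) (x : 'rV[int]_d), 0 < t -> U (t, x) ->
    f t x = left_limit f t x +
      \prod_(n <- neighbours d)
        (left_limit f t x <= left_limit f t (x + n))%R%:R
}.

Definition rsos_model (disp : measure_display) (Omega : measurableType disp)
    (R : realType) (P : probability Omega R) (d : nat)
    (U : Omega -> set (R * 'rV[int]_d)) (f0 : 'rV[int]_d -> int)
    (f : R -> 'rV[int]_d -> Omega -> int) : Prop :=
  (forall (t : R) (x : 'rV[int]_d), 0 <= t -> measurable_fun setT (fun w => (f t x w)%:~R : R)) /\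
  {ae P, forall w, rsos_path (U w) f0 (fun t x => f t x w)}.

(* Main.v *)
Require Import Defs.
From mathcomp Require Import all_boot all_order all_algebra.
From mathcomp Require Import all_classical all_reals all_analysis.
From mathcomp Require Import measurable_realfun.
From mathcomp Require Import zify ring lra.
Import Order.TTheory GRing.Theory Num.Theory.
Import numFieldNormedType.Exports.

Set Implicit Arguments.
Unset Strict Implicit.
Unset Printing Implicit Defensive.

Local Open Scope classical_set_scope.
Local Open Scope ring_scope.

(** RSOS heights that start flat differ by at most one between neighbours, so
a ring at [y] replaces the height at [y] by one plus the minimum of the heights
at [y] and at its neighbours ([step_rsos]).  The height [f(t, x)] is therefore a
first-passage time: the least number of rings met by a backward path from
[(t, x)] that may jump to a neighbour whenever it meets a ring.  Two facts
follow.  One additional ring raises [f(t, x)] by [0] or [1], and it has no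
effect unless it lies on a fixed optimal path of the original configuration.
By the Poincare (Efron-Stein) inequality for the Poisson process the variance
is at most the expected intensity of the set of space-time points at which an
additional ring matters.  At each time there is at most one such site, so this
is at most [t].

The argument is carried out on a discretisation of [[0, t]] into [m = 2 ^ k]
slots of length [t / m], with one bit for each slot and each site of a finite
region, telling whether the site rings during the slot.  The bits are
independent Bernoulli variables of parameter [p <= t / m], and the discrete
height after [m] slots is a function of them.  The Efron-Stein inequality for
Bernoulli bits ([efron_stein]) bounds its variance by [p] times the expected
number of influential empty cells.  There is at most one of these per slot
([height_energy]), whence the bound [m * p <= t].

Almost surely the discrete height is equal to [f(t, x)] for all large [k].  A
height [K] is determined by the rings within [K] jumps of [x]: a path that
leaves this region meets more than [K] rings ([height_path]).  Inside a finite
region the rings are separated by a fine enough mesh, as a slot carries two of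
them with probability of order [m ^ -2] ([ae_mesh_sparse]).  The bound passes to
the limit by Fatou's lemma, with a cluster point of the discrete means in place
of their limit ([fatou_variance_le]). *)

(** * The Efron-Stein inequality for Bernoulli bits *)

Section Bernoulli.
Variables (R : realType) (C : eqType) (p : R).
Hypotheses (p0 : 0 <= p) (p1 : p <= 1).

Definition set_bit (c : C) (b : bool) (w : C -> bool) : C -> bool :=
  fun e => if e == c then b else w e.

(** The expectation of [G] when the bits indexed by [cs] are independent
Bernoulli variables of parameter [p] and all other bits are [false]. *)
Fixpoint bernoulli_mean (cs : seq C) (G : (C -> bool) -> R) : R :=
  if cs is c :: cs' then
    (1 - p) * bernoulli_mean cs' (G \o set_bit c false) +
    p * bernoulli_mean cs' (G \o set_bit c true)
  else G (fun _ => false).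

Lemma bernoulli_meanD cs G H :
  bernoulli_mean cs (fun w => G w + H w) = bernoulli_mean cs G + bernoulli_mean cs H.
Proof.
elim: cs G H => [//|c cs IH] G H /=.
rewrite (_ : _ \o set_bit c false =
  fun w => (G \o set_bit c false) w + (H \o set_bit c false) w) //.
rewrite (_ : _ \o set_bit c true =
  fun w => (G \o set_bit c true) w + (H \o set_bit c true) w) //.
rewrite !IH; ring.
Qed.

Lemma bernoulli_meanZ cs a G :
  bernoulli_mean cs (fun w => a * G w) = a * bernoulli_mean cs G.
Proof.
elim: cs G => [//|c cs IH] G /=.
rewrite (IH (G \o set_bit c false)) (IH (G \o set_bit c true)); ring.
Qed.

Lemma bernoulli_mean_cst cs a : bernoulli_mean cs (fun=> a) = a.
Proof. elim: cs => [//|c cs IH] /=; rewrite !IH; ring. Qed.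

Lemma bernoulli_mean_sum cs (I : Type) (r : seq I) (F : I -> (C -> bool) -> R) :
  bernoulli_mean cs (fun w => \sum_(i <- r) F i w) =
  \sum_(i <- r) bernoulli_mean cs (F i).
Proof.
elim: r => [|i r IH].
  rewrite big_nil -[RHS](bernoulli_mean_cst cs); congr bernoulli_mean.
  by apply/funext => w; rewrite big_nil.
rewrite big_cons -IH -bernoulli_meanD; congr bernoulli_mean.
by apply/funext => w; rewrite big_cons.
Qed.

Lemma le_bernoulli_mean cs G H : (forall w, G w <= H w) ->
  bernoulli_mean cs G <= bernoulli_mean cs H.
Proof.
elim: cs G H => [|c cs IH] G H GH /=; first exact: GH.
by apply: lerD; apply: ler_wpM2l; rewrite ?subr_ge0//; apply: IH => w; exact: GH.
Qed.

Lemma bernoulli_mean_bit cs c : uniq cs ->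
  bernoulli_mean cs (fun w => (w c)%:R) = if c \in cs then p else 0.
Proof.
elim: cs => [//|e cs IH] /= /andP[ecs ucs]; rewrite in_cons.
rewrite /comp /set_bit /=; case: eqVneq => [->|ce] /=.
  by rewrite !bernoulli_mean_cst; ring.
by rewrite IH//; case: ifP => _; ring.
Qed.

Lemma bernoulli_mean_sqr cs G a :
  bernoulli_mean cs (fun w => (G w - a) ^+ 2) =
  bernoulli_mean cs (fun w => G w ^+ 2) - bernoulli_mean cs G ^+ 2 +
  (bernoulli_mean cs G - a) ^+ 2.
Proof.
rewrite (_ : (fun w => (G w - a) ^+ 2) =
   fun w => G w ^+ 2 + ((- 2 * a) * G w + a ^+ 2)); last first.
  by apply/funext => w; ring.
rewrite bernoulli_meanD (bernoulli_meanD _ (fun w => - 2 * a * G w)).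
by rewrite bernoulli_meanZ bernoulli_mean_cst; ring.
Qed.

Lemma sqr_bernoulli_mean cs G :
  bernoulli_mean cs G ^+ 2 <= bernoulli_mean cs (fun w => G w ^+ 2).
Proof.
have := le_bernoulli_mean cs (G := fun=> 0)
  (H := fun w => (G w - bernoulli_mean cs G) ^+ 2).
rewrite bernoulli_mean_cst bernoulli_mean_sqr => /(_ (fun w => sqr_ge0 _)); lra.
Qed.

Lemma set_bit_set_bit c b b' w : set_bit c b (set_bit c b' w) = set_bit c b w.
Proof. by apply/funext => e; rewrite /set_bit; case: ifP => // ->. Qed.

Lemma set_bitC c e b b' w : e != c ->
  set_bit c b (set_bit e b' w) = set_bit e b' (set_bit c b w).
Proof.
move=> ec; apply/funext => x; rewrite /set_bit.
by case: (eqVneq x e) => [->|//]; rewrite (negPf ec).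
Qed.

(** The discrete form of the integrated squared add-one cost in the Poincare
inequality of the Poisson process. *)
Definition add_one_energy (cs : seq C) (G : (C -> bool) -> R) (w : C -> bool) : R :=
  \sum_(c <- cs) (~~ w c)%:R * (G (set_bit c true w) - G w) ^+ 2.

Lemma add_one_energy_set_bit cs G c b w : c \notin cs ->
  add_one_energy cs G (set_bit c b w) = add_one_energy cs (G \o set_bit c b) w.
Proof.
move=> ccs; apply: eq_big_seq => e ecs.
have ec : e != c by apply: contraNneq ccs => <-.
by rewrite /= -set_bitC// {1}/set_bit (negPf ec).
Qed.

(** By induction on the bits.  Conditioning on the first bit splits the variance
into the mean of the two conditional variances and the variance of the
conditional mean; the latter is [p * (1 - p)] times the square of a mean, at
most the mean of the square by [sqr_bernoulli_mean].  The factor [1 - p] is the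
probability that the bit is [false], which is why the energy only keeps the
empty cells. *)
Lemma efron_stein cs G : uniq cs ->
  bernoulli_mean cs (fun w => G w ^+ 2) - bernoulli_mean cs G ^+ 2 <=
  p * bernoulli_mean cs (add_one_energy cs G).
Proof.
elim: cs G => [|c cs IH] G /=; first by rewrite /add_one_energy big_nil; lra.
move=> /andP[ccs ucs].
set G0 := G \o set_bit c false; set G1 := G \o set_bit c true.
have IH0 := IH G0 ucs; have IH1 := IH G1 ucs.
have E0 : bernoulli_mean cs (add_one_energy (c :: cs) G \o set_bit c false) =
    bernoulli_mean cs (fun w => (G1 w - G0 w) ^+ 2) +
    bernoulli_mean cs (add_one_energy cs G0).
  rewrite -bernoulli_meanD; congr bernoulli_mean; apply/funext => w /=.
  by rewrite -add_one_energy_set_bit// {1}/add_one_energy big_cons set_bit_set_bit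
    {1}/set_bit eqxx mul1r.
have E1 : bernoulli_mean cs (add_one_energy (c :: cs) G \o set_bit c true) =
    bernoulli_mean cs (add_one_energy cs G1).
  congr bernoulli_mean; apply/funext => w /=.
  by rewrite -add_one_energy_set_bit// {1}/add_one_energy big_cons
    {1}/set_bit eqxx mul0r add0r.
rewrite E0 E1.
have J := sqr_bernoulli_mean cs (fun w => G1 w - G0 w).
rewrite (_ : bernoulli_mean cs (fun w => G1 w - G0 w) =
  bernoulli_mean cs G1 - bernoulli_mean cs G0) in J; last first.
  rewrite -mulN1r -bernoulli_meanZ -bernoulli_meanD.
  by congr bernoulli_mean; apply/funext => w; rewrite mulN1r.
rewrite -!/(_ \o _) (_ : (fun w => G w ^+ 2) \o set_bit c false = fun w => G0 w ^+ 2) //.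
rewrite (_ : (fun w => G w ^+ 2) \o set_bit c true = fun w => G1 w ^+ 2) //.
have q0 : 0 <= 1 - p by rewrite subr_ge0.
have := ler_wpM2l p0 IH1; have := ler_wpM2l q0 IH0.
have := ler_wpM2l (mulr_ge0 p0 q0) J.
move: (bernoulli_mean _ _) (bernoulli_mean _ _) (bernoulli_mean _ _)
  (bernoulli_mean _ _) (bernoulli_mean _ _) (bernoulli_mean _ _) => a1 a2 a3 a4 a5 a6.
move: (bernoulli_mean _ _) => a7.
nra.
Qed.
End Bernoulli.

(** * Discrete heights as first-passage times *)

Section Discrete.
Variables (V : zmodType) (N : seq V).
Implicit Types (u : V -> nat) (b : V -> bool) (w : nat * V -> bool).

Definition min_height u y : nat := foldr minn (u y) [seq u (y + n) | n <- N].

Lemma min_height_self u y : (min_height u y <= u y)%N.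
Proof. rewrite /min_height; elim: N => //= n s IH; lia. Qed.

Lemma min_height_nbr u y n : n \in N -> (min_height u y <= u (y + n)%R)%N.
Proof.
rewrite /min_height; elim: N => //= e s IH; rewrite in_cons.
by case/orP => [/eqP ->|/IH]; lia.
Qed.

Lemma min_height_attained u y :
  min_height u y = u y \/ exists2 n, n \in N & min_height u y = u (y + n).
Proof.
rewrite /min_height; elim: N => [|e s IH] /=; first by left.
set m := foldr _ _ _ in IH *.
have [em|me] := leqP (u (y + e)) m.
  by right; exists e; rewrite ?mem_head.
case: IH => [|[n ns nE]]; first by left.
by right; exists n; rewrite // in_cons ns orbT.
Qed.

Definition step b u y : nat := if b y then (min_height u y).+1 else u y.

(** Locality of the minimum: only the site where it is attained can make the
result larger.  Iterated over the slots, this follows an optimal path. *)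
Lemma step_le_at_site b u y : exists z,
  forall u', (u' z <= u z)%N -> (step b u' y <= step b u y)%N.
Proof.
rewrite /step; case: (b y); last by exists y.
have [->|[n nN ->]] := min_height_attained u y.
  by exists y => u' u'u; rewrite ltnS (leq_trans (min_height_self _ _)).
by exists (y + n) => u' u'u; rewrite ltnS (leq_trans (min_height_nbr _ _ nN)).
Qed.

Lemma le_step b u u' : (forall y, u y <= u' y)%N ->
  forall y, (step b u y <= step b u' y)%N.
Proof. by move=> uu' y; have [z] := step_le_at_site b u' y; apply. Qed.

Lemma step_succ b u y : step b (fun z => (u z).+1) y = (step b u y).+1.
Proof.
rewrite /step; case: ifP => // _; congr _.+1; rewrite /min_height.
by elim: N => //= n s ->; rewrite minnSS.
Qed.

Lemma step_le_self b u y : (step b u y <= u y + b y)%N.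
Proof.
rewrite /step; case: ifP => _; last by rewrite addn0.
by rewrite addn1 ltnS min_height_self.
Qed.

Definition one_lipschitz u := forall y n, n \in N -> (u y <= (u (y + n)%R).+1)%N.

Lemma le_min_height u y : one_lipschitz u -> (u y <= (min_height u y).+1)%N.
Proof.
by move=> u1; have [->|[n nN ->]] := min_height_attained u y; [lia|exact: u1].
Qed.

Lemma le_step_self b u y : one_lipschitz u -> (u y <= step b u y)%N.
Proof. by move=> u1; rewrite /step; case: (b y) => //; exact: le_min_height. Qed.

Lemma step_one_lipschitz b u : one_lipschitz u -> one_lipschitz (step b u).
Proof.
move=> u1 y n nN; rewrite {1}/step; case: (b y).
  by rewrite ltnS (leq_trans (min_height_nbr _ _ nN))// le_step_self.
by rewrite (leq_trans (u1 y n nN))// ltnS le_step_self.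
Qed.

(** On 1-Lipschitz heights a site above one of its neighbours exceeds the
minimum by exactly one, so that the min-plus rule leaves it in place: this is
the RSOS rule. *)
Lemma step_rsos b u y : one_lipschitz u ->
  step b u y = (u y + (b y && all (fun n => u y <= u (y + n)%R)%N N))%N.
Proof.
move=> u1; rewrite /step; case: (b y); last by rewrite addn0.
rewrite andTb; have := le_min_height y u1; have := min_height_self u y.
case: allP => [uN _ _|uN].
  rewrite addn1; congr _.+1; have [//|[n nN e]] := min_height_attained u y.
  by apply/eqP; rewrite eqn_leq min_height_self e uN.
suff : min_height u y != u y by lia.
apply: contra_notN uN => /eqP <- n; exact: min_height_nbr.
Qed.

(** Discrete heights from the flat profile: in slot [i] the sites [y] with
[w (i, y)] ring simultaneously. *)
Fixpoint height w j : V -> nat :=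
  if j is i.+1 then step (fun y => w (i, y)) (height w i) else fun=> 0%N.

Lemma height_one_lipschitz w j : one_lipschitz (height w j).
Proof. by elim: j => //= j; exact: step_one_lipschitz. Qed.

Lemma height_le_rings w j x : (height w j x <= \sum_(i < j) w (i : nat, x))%N.
Proof.
elim: j => [|j IH] //=; rewrite big_ord_recr /=.
by rewrite (leq_trans (step_le_self _ _ _))// leq_add2r.
Qed.

(** The site [z] is where an optimal backward path from [(j + k, x)] sits at the
start of slot [j].  It depends on [w] but not on the competitor [w']. *)
Lemma height_le_at_site w j k x : exists z, forall w',
  (forall i y, (j <= i)%N -> w' (i, y) = w (i, y)) ->
  (height w' j z <= height w j z)%N ->
  (height w' (j + k)%N x <= height w (j + k)%N x)%N.
Proof.
elim: k x => [|k IH] x; first by exists x => w'; rewrite addn0.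
rewrite addnS /=.
have [y yP] := step_le_at_site (fun y => w ((j + k)%N, y)) (height w (j + k)%N) x.
have [z zP] := IH y; exists z => w' w'w le_z.
suff -> : (fun y => w' ((j + k)%N, y)) = (fun y => w ((j + k)%N, y)).
  by apply: yP; exact: zP.
by apply/funext => e; apply: w'w; exact: leq_addr.
Qed.

Section add_ring.
Variables (w : nat * V -> bool) (c : nat * V).
Hypothesis wc : ~~ w c.
Let w' := set_bit c true w.

Lemma height_add_ring_before i : (i <= c.1)%N -> height w' i = height w i.
Proof.
elim: i => //= i IH ic; rewrite IH; last exact: ltnW.
congr step; apply/funext => y; rewrite /w' /set_bit; case: eqVneq => // e.
by move: ic; rewrite -e ltnn.
Qed.

Lemma height_add_ring_other y : y != c.2 -> height w' c.1.+1 y = height w c.1.+1 y.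
Proof.
move=> yc /=; rewrite height_add_ring_before// /step /w' /set_bit.
by case: eqVneq => // e; move: yc; rewrite -e eqxx.
Qed.

(** The step map is monotone and commutes with adding one, so the initial
discrepancy of at most one at the site of the new ring never grows. *)
Lemma height_add_ring i y :
  (height w i y <= height w' i y <= (height w i y).+1)%N.
Proof.
elim: i y => [//|i IH] y.
have [ltic|gtic|eic] := ltngtP i c.1.
- by rewrite height_add_ring_before// leqnn leqnSn.
- have e : (fun y => w' (i, y)) = (fun y => w (i, y)).
    apply/funext => z; rewrite /w' /set_bit; case: eqVneq => // e.
    by move: gtic; rewrite -e ltnn.
  rewrite /= e; apply/andP; split; first by apply: le_step => z; case/andP: (IH z).
  by rewrite -step_succ; apply: le_step => z; case/andP: (IH z).
- have [->|yc] := eqVneq y c.2; last first.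
    by rewrite eic height_add_ring_other// leqnn leqnSn.
  rewrite eic /= height_add_ring_before//.
  have -> : step (fun y => w (c.1, y)) (height w c.1) c.2 = height w c.1 c.2.
    by rewrite /step -surjective_pairing (negPf wc).
  rewrite le_step_self ?(leq_trans (step_le_self _ _ _)) ?addn1//.
    by rewrite -[leqRHS]addn1 leq_add2l leq_b1.
  exact: height_one_lipschitz.
Qed.

End add_ring.

(** In each slot the new ring matters only if it is put at the site of
[height_le_at_site], so at most one empty cell per slot contributes, and it
contributes at most one. *)
Lemma height_energy (R : realType) w m x (cs : seq (nat * V)) :
  uniq cs -> (forall c, c \in cs -> (c.1 < m)%N) ->
  add_one_energy cs (fun w => (height w m x)%:R : R) w <= m%:R.
Proof.
move=> ucs csm.
have /choice[z zP] : forall j, exists z, forall w', (j < m)%N ->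
    (forall i y, (j < i)%N -> w' (i, y) = w (i, y)) ->
    (height w' j.+1 z <= height w j.+1 z)%N -> (height w' m x <= height w m x)%N.
  move=> j; have [jm|] := ltnP j m; last by exists x.
  have [z zP] := height_le_at_site w j.+1 (m - j.+1) x.
  by exists z => w' _; rewrite subnKC// in zP; exact: zP.
pose pathc := [seq (j, z j) | j <- iota 0 m].
apply: (@le_trans _ _ (\sum_(c <- cs) (c \in pathc)%:R)).
  rewrite /add_one_energy big_seq [leRHS]big_seq.
  apply: ler_sum => c /csm cm.
  case: (boolP (w c)) => wc; first by rewrite mul0r.
  rewrite mul1r; have /andP[le1 le2] := height_add_ring wc m x.
  case: (boolP (c \in pathc)) => cp.
    rewrite -natrB// -natrX ler_nat.
    by rewrite -[leqRHS](exp1n 2) leq_exp2r// leq_subLR addn1.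
  suff -> : height (set_bit c true w) m x = height w m x by rewrite subrr expr0n.
  apply/eqP; rewrite eqn_leq le1 andbT; apply: (zP c.1) => //.
    move=> i y ci; rewrite /set_bit; case: eqVneq => // e.
    by move: ci; rewrite -e ltnn.
  rewrite height_add_ring_other//; apply: contraNneq cp => e.
  by apply/mapP; exists c.1; rewrite ?mem_iota// e -surjective_pairing.
rewrite -natr_sum ler_nat -[leqRHS](size_iota 0) -(size_map (fun j => (j, z j))).
rewrite -/pathc -big_mkcond /= sum1_count -size_filter.
apply: uniq_leq_size; first exact: filter_uniq.
by move=> c; rewrite mem_filter => /andP[].
Qed.
End Discrete.

(** * Comparison of a path with the discrete heights *)

Lemma prodr_nat_all (I : Type) (r : seq I) (a : pred I) :
  \prod_(i <- r) (a i)%:R = (all a r)%:R :> int.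
Proof.
elim: r => [|i r IH]; first by rewrite big_nil.
by rewrite big_cons IH /= -natrM mulnb.
Qed.

Section Path.
Variables (R : realType) (d : nat).
Implicit Types (U : set (R * 'rV[int]_d)) (g : R -> 'rV[int]_d -> int).

Definition rings U (a b : R) (y : 'rV[int]_d) := exists2 r, a < r <= b & U (r, y).

Definition sparse U (B : seq 'rV[int]_d) (a b : R) :=
  forall p q, U p -> U q -> a < p.1 <= b -> a < q.1 <= b ->
    p.2 \in B -> q.2 \in B -> p = q.

Lemma sparseS U B B' a a' b b' : {subset B' <= B} -> a <= a' -> b' <= b ->
  sparse U B a b -> sparse U B' a' b'.
Proof.
move=> B'B aa' b'b sp p q Up Uq /andP[ap pb] /andP[aq qb] pB qB.
apply: sp => //; try exact: B'B.
  by rewrite (le_lt_trans aa' ap) (le_trans pb b'b).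
by rewrite (le_lt_trans aa' aq) (le_trans qb b'b).
Qed.

Lemma left_limit_no_ring U f0 g a r y : rsos_path U f0 g -> 0 <= a -> a < r ->
  (forall s, a < s < r -> ~ U (s, y)) -> left_limit g r y = g a y.
Proof.
move=> gp a0 ar nU.
have lim : is_left_limit g r y (g a y).
  near=> s; apply: (rsos_constant gp) => //; first by near: s; exact: nbhs_left_ge.
  have sr : s < r by near: s; exact: nbhs_left_lt.
  by move=> q aq qs; apply: nU; rewrite aq (le_lt_trans qs sr).
apply: (@xget_unique _ _ [set h | is_left_limit g r y h]) => // h hlim.
have : \forall s \near r^'-, g a y = h.
  by near=> s; transitivity (g s y); [apply/esym; near: s|near: s].
by move/filter_ex => [].
Unshelve. all: by end_near. Qed.

(** With at most one ring in the region during the slot, no neighbour has moved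
since the start of the slot when [y] rings. *)
Lemma sparse_increment U f0 g B a b y : rsos_path U f0 g -> 0 <= a -> a <= b ->
  sparse U B a b -> y \in B -> (forall n, n \in neighbours d -> y + n \in B) ->
  g b y = g a y +
    (`[< rings U a b y >] && all (fun n => g a y <= g a (y + n)) (neighbours d))%:R.
Proof.
move=> gp a0 ab sp yB nB; case: asboolP => [[r /andP[ar rb] Ur]|nr]; last first.
  rewrite addr0; apply: (rsos_constant gp) => // r ar rb Ur.
  by apply: nr; exists r; rewrite ?ar.
have r_only s z : a < s -> s <= b -> z \in B -> U (s, z) -> s = r /\ z = y.
  move=> as_ sb zB Us.
  suff [-> ->] : (s, z) = (r, y) by [].
  by apply: sp; rewrite //= ?as_ ?ar.
have lim z : z \in B -> left_limit g r z = g a z.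
  move=> zB; apply: (left_limit_no_ring gp) => // s /andP[as_ sr] Us.
  have [e _] := r_only s z as_ (le_trans (ltW sr) rb) zB Us.
  by rewrite e ltxx in sr.
have -> : g b y = g r y.
  apply: (rsos_constant gp) => //; first exact: le_trans a0 (ltW ar).
  move=> s rs sb Us; have [e _] := r_only s y (lt_trans ar rs) sb yB Us.
  by rewrite e ltxx in rs.
rewrite (rsos_update gp) ?lim//; last exact: le_lt_trans ar.
congr (_ + _); rewrite /= -prodr_nat_all.
by apply: eq_big_seq => n nN; rewrite !lim ?nB.
Qed.

Fixpoint nbhd (l : nat) (x : 'rV[int]_d) : seq 'rV[int]_d :=
  if l is k.+1 then [seq y + n | y <- nbhd k x, n <- 0 :: neighbours d] else [:: x].

Lemma nbhdS l x y n : y \in nbhd l x -> n \in 0 :: neighbours d ->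
  y + n \in nbhd l.+1 x.
Proof. by move=> yl nN; apply/allpairsP; exists (y, n). Qed.

Lemma sub_nbhd k l x : (k <= l)%N -> {subset nbhd k x <= nbhd l x}.
Proof.
move=> kl y; rewrite -(subnKC kl); elim: (l - k)%N => [|i IH]; rewrite ?addn0// => /IH.
by move=> yi; rewrite addnS -[y]addr0; apply: nbhdS => //; exact: mem_head.
Qed.

(** The path is only controlled in a finite region, whereas heights at its
boundary depend on the exterior.  A height below [k] at [y] depends on the
neighbours only through their heights truncated at [k - 1].  So two heights that
agree when truncated at [k] within distance [K + 1 - k] of [x] still do so after
a slot, and at [x] itself the truncation level is [K + 1]. *)
Lemma height_path U g (tau : nat -> R) (w : nat * 'rV[int]_d -> bool) m K x :
  rsos_path U (fun=> 0) g ->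
  tau 0%N = 0 -> {homo tau : i j / (i <= j)%N >-> i <= j} ->
  (forall j, (j < m)%N -> sparse U (nbhd K.+2 x) (tau j) (tau j.+1)) ->
  (forall j y, (j < m)%N -> y \in nbhd K.+2 x ->
    w (j, y) = `[< rings U (tau j) (tau j.+1) y >]) ->
  g (tau m) x <= K%:Z -> (height (neighbours d) w m x)%:Z = g (tau m) x.
Proof.
move=> gp tau0 tauS sp wE gK.
have tau_ge0 j : 0 <= tau j by rewrite -tau0 tauS.
suff agree : forall j, (j <= m)%N -> forall k y, (k <= K.+1)%N ->
    y \in nbhd (K.+1 - k) x ->
    let h := height (neighbours d) w j y in
    (g (tau j) y = h%:Z) \/ (k%:Z <= g (tau j) y) /\ (k <= h)%N.
  have := agree m (leqnn m) K.+1 x (leqnn _).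
  rewrite subnn mem_head => /(_ isT) /= [-> //|[Kg _]].
  by have := le_trans Kg gK; rewrite lez_nat ltnn.
elim=> [_ k y _ _|j IH jm k y kK yk] /=; first by rewrite tau0 (rsos_init gp); left.
have jm' := ltnW jm.
have yB : y \in nbhd K.+2 x by apply: sub_nbhd yk; lia.
have nB n : n \in neighbours d -> y + n \in nbhd (K.+1 - k).+1 x.
  by move=> nN; apply: nbhdS => //; rewrite in_cons nN orbT.
(* Distance [K + 2] is needed for the neighbours of the sites with [k = 0]. *)
rewrite (sparse_increment gp _ _ (sp j jm))//; last 2 first.
- exact: tauS.
- by move=> n nN; apply: sub_nbhd (nB n nN); lia.
rewrite -wE// step_rsos; last exact: height_one_lipschitz.
have := IH jm' k y kK yk.
set a := g (tau j) y; set h := height _ _ _ _ => ah.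
have [hk|kh] := ltnP h k; last first.
  by right; case: ah => [->|[]]; lia.
left; case: ah => [ah|]; last lia.
rewrite ah PoszD; congr (_ + _).
rewrite -[RHS]/((nat_of_bool _)%:Z) natz; congr (Posz (nat_of_bool (_ && _))).
apply: eq_in_all => n nN.
have := IH jm' k.-1 (y + n); rewrite (_ : (K.+1 - k.-1 = (K.+1 - k).+1)%N); last lia.
move=> /(_ ltac:(lia) (nB n nN)) /=.
case=> [->|[kg kh]]; first by rewrite lez_nat.
rewrite (leq_trans _ kh); last lia.
by rewrite (le_trans _ kg)// lez_nat; lia.
Qed.

End Path.

(** * Functions of independent bits *)

Section Link.
Variables (R : realType) (disp : measure_display) (Omega : measurableType disp).
Variables (P : probability Omega R) (C : eqType) (p : R) (bit : C -> Omega -> bool).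
Hypothesis mbit : forall c, measurable [set w | bit c w].

Definition outcome (cs : seq C) (w : Omega) : C -> bool :=
  fun c => (c \in cs) && bit c w.

(** Induction on [cs]: the event [A] records the values of the bits already
revealed.  The number [a] stands for [P A] so that the hypothesis is inherited
by [A] intersected with a value of the next bit without summing over the
remaining ones. *)
Lemma integral_outcome cs (A : set Omega) (a : R) (G : (C -> bool) -> R) :
  uniq cs -> measurable A -> (forall v, 0 <= G v) ->
  (forall v, P (A `&` [set w | forall c, c \in cs -> bit c w = v c]) =
    (a * \prod_(c <- cs) (if v c then p else 1 - p))%:E) ->
  measurable_fun A (fun w => (G (outcome cs w))%:E) /\
  (\int[P]_(w in A) (G (outcome cs w))%:E = (a * bernoulli_mean p cs G)%:E)%E.
Proof.
move=> + + G0; elim: cs A a G G0 => [|c cs IH] A a G G0 /= ucs mA PA.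
  have -> : (fun w => (G (outcome [::] w))%:E) = cst (G (fun=> false))%:E by [].
  split; first exact: measurable_cst.
  rewrite integral_cst//; have := PA (fun=> false).
  rewrite (_ : [set w | _] = setT) ?setIT; last by apply/seteqP; split.
  rewrite big_nil mulr1 => PAa.
  by rewrite [X in (_ * X)%E](_ : _ = a%:E) ?PAa// -EFinM mulrC.
move: ucs => /andP[ccs ucs].
pose Ab b := A `&` [set w | bit c w = b].
have mAb b : measurable (Ab b).
  apply: measurableI => //; case: b; first exact: mbit.
  rewrite (_ : [set w | _] = ~` [set w | bit c w]); first exact/measurableC/mbit.
  by apply/seteqP; split => w /=; [move=> ->|move/negP/negbTE].
have AU : A = Ab false `|` Ab true.
  rewrite -setIUr (_ : _ `|` _ = setT) ?setIT//.
  by apply/seteqP; split => // w _ /=; case: (bit c w); [right|left].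
have outE b w : Ab b w -> outcome (c :: cs) w = set_bit c b (outcome cs w).
  case=> _ /= bc; apply/funext => e; rewrite /outcome /set_bit in_cons.
  by case: eqVneq => [->|].
have {}IH b := IH (Ab b) (a * (if b then p else 1 - p)) (G \o set_bit c b)
  (fun v => G0 _) ucs (mAb b).
have PAb b v : P (Ab b `&` [set w | forall e, e \in cs -> bit e w = v e]) =
    (a * (if b then p else 1 - p) * \prod_(e <- cs) (if v e then p else 1 - p))%:E.
  rewrite -setIA -mulrA.
  have := PA (set_bit c b v); rewrite big_cons [set_bit c b v c]/set_bit eqxx.
  rewrite (eq_big_seq (fun e => if v e then p else 1 - p)); last first.
    by move=> e ecs; rewrite /set_bit; case: eqVneq => // ec; rewrite -ec ecs in ccs.
  move=> <-; congr (P (_ `&` _)); apply/seteqP; split => w /=.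
    case=> bc bcs e; rewrite in_cons /set_bit; case: eqVneq => [-> //|ec /=].
    exact: bcs.
  move=> h; split; first by rewrite h ?mem_head// /set_bit eqxx.
  move=> e ecs; rewrite h ?in_cons ?ecs ?orbT// /set_bit.
  by case: eqVneq => // ec; rewrite -ec ecs in ccs.
have mG b : measurable_fun (Ab b) (fun w => (G (outcome (c :: cs) w))%:E).
  apply: eq_measurable_fun (IH b (PAb b)).1 => w.
  by rewrite inE => Abw; rewrite (outE b).
have mGA : measurable_fun (Ab false `|` Ab true) (fun w => (G (outcome (c :: cs) w))%:E).
  exact/measurable_funU.
split; first by rewrite AU.
rewrite {1}AU ge0_integral_setU//; last 2 first.
  by move=> w _; rewrite lee_fin.
  by rewrite disj_set2E; apply/eqP/seteqP; split => // w [[_ /= wF] [_ /=]]; rewrite wF.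
have intE b : (\int[P]_(w in Ab b) (G (outcome (c :: cs) w))%:E =
    (a * (if b then p else 1 - p) * bernoulli_mean p cs (G \o set_bit c b))%:E)%E.
  rewrite -(IH b (PAb b)).2; apply: eq_integral => w.
  by rewrite inE => Abw; rewrite (outE b).
by rewrite !intE -EFinD; congr EFin; ring.
Qed.
End Link.

(** * Counts of the Poisson process in space-time cells *)

Section Counting.
Variables (R : realType) (T : choiceType).
Implicit Types A : set T.

Lemma counting0P A : (counting A == 0%:R%:E :> \bar R) = (A == set0).
Proof.
apply/eqP/eqP => [|->]; rewrite /counting; last first.
  by rewrite asboolT ?fset_set0 ?finmap.cardfs0.
case: asboolP => // fA [] /eqP; rewrite eqr_nat finmap.cardfs_eq0 => /eqP.
exact: fset_set_set0.
Qed.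

Lemma counting1_eq A : counting A = 1%:R%:E :> \bar R ->
  forall x y, A x -> A y -> x = y.
Proof.
rewrite /counting; case: asboolP => // fA [] /eqP; rewrite eqr_nat.
move=> /finmap.cardfs1P[z Az] x y.
by rewrite -(fset_setK fA) Az /= !finmap.inE => /eqP -> /eqP.
Qed.
End Counting.

Section Poisson.
Variables (R : realType).

Lemma poisson_prob0 (r : R) k : 0 <= r -> poisson_prob r k [set 0%N] = (expR (- r))%:E.
Proof.
rewrite le_eqVlt /poisson_prob => /predU1P[<-|r0].
  by rewrite ltxx oppr0 expR0 diracE mem_set.
rewrite r0 esum_set1 ?lee_fin ?poisson_pmf_ge0//.
by rewrite /poisson_pmf r0 expr0 fact0 invr1 !mul1r.
Qed.

Lemma poisson_prob1 (r : R) k : 0 <= r ->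
  poisson_prob r k [set 1%N] = (r * expR (- r))%:E.
Proof.
rewrite le_eqVlt /poisson_prob => /predU1P[<-|r0].
  by rewrite ltxx diracE mul0r memNset.
rewrite r0 esum_set1 ?lee_fin ?poisson_pmf_ge0//.
by rewrite /poisson_pmf r0 expr1 -[(1`!)%N]/1%N invr1 mulr1.
Qed.

End Poisson.

Section Slab.
Variables (R : realType) (d : nat) (disp : measure_display).
Variables (Omega : measurableType disp) (P : probability Omega R).
Variable (U : Omega -> set (R * 'rV[int]_d)).
Hypothesis UP : poisson_point_process P U.

Definition slab (a b : R) (B : seq 'rV[int]_d) : set (R * 'rV[int]_d) :=
  [set q | a < q.1 <= b /\ q.2 \in B].

Lemma ysection_slab a b B y :
  ysection (slab a b B) y = if y \in B then `]a, b]%classic else set0.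
Proof.
apply/seteqP; split => s; rewrite /ysection /= inE /slab /=.
  by case=> ab ->; rewrite /= in_itv.
by case: ifP => //= _; rewrite in_itv.
Qed.

Lemma slab_measurable a b B : 0 <= a -> spacetime_measurable (slab a b B).
Proof.
move=> a0; split => [q /= [/andP[aq _] _]|y]; first exact: le_trans (ltW aq).
by rewrite ysection_slab; case: ifP.
Qed.

Lemma slab_intensity a b B : uniq B -> a <= b ->
  spacetime_intensity (slab a b B) = ((size B)%:R * (b - a))%:E.
Proof.
move=> uB ab; rewrite /spacetime_intensity.
rewrite (eq_esum (b := fun y => if y \in [set` B] then (b - a)%:E else 0%E)).
  rewrite -esum_mkcond esum_fset; [|exact: finite_seq|]; last first.
    by move=> i _; rewrite lee_fin subr_ge0.
  by rewrite -fsbig_seq// sumEFin big_const_seq count_predT iter_addr_0 mulr_natl.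
move=> y _; rewrite ysection_slab mem_setE; case: ifP => _; last exact: measure0.
rewrite lebesgue_measure_itv /= lte_fin; case: ltP => [//|ba].
by rewrite (@le_anti _ _ a b) ?ab// subrr.
Qed.

Lemma slab_count_law a b B : 0 <= a -> a <= b -> uniq B -> forall k,
  P [set w | point_count U (slab a b B) w = k%:R%:E] =
  poisson_prob ((size B)%:R * (b - a)) 0%N [set k].
Proof.
move=> a0 ab uB k; have mS := slab_measurable b B a0.
by rewrite (ppp_law UP mS) slab_intensity// ltry.
Qed.

Lemma measurable_slab_count a b B (D : set (\bar R)) : 0 <= a -> measurable D ->
  measurable (point_count U (slab a b B) @^-1` D).
Proof.
move=> a0 mD; rewrite -[_ @^-1` _]setTI.
exact: (ppp_measurable UP (slab_measurable b B a0)).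
Qed.

(** A Poisson variable of mean [r] exceeds [1] with probability
[1 - (1 + r) * expR (- r)], and [expR (- r) >= 1 - r]. *)
Lemma slab_multiple_prob a b B : 0 <= a -> a <= b -> uniq B ->
  exists2 E, measurable E &
    (forall w, ~ E w -> sparse (U w) B a b) /\
    (P E <= (((size B)%:R * (b - a)) ^+ 2)%:E)%E.
Proof.
move=> a0 ab uB; pose X := point_count U (slab a b B).
set r := (size B)%:R * (b - a); have r0 : 0 <= r by rewrite mulr_ge0// subr_ge0.
have m1 (k : nat) : measurable (X @^-1` [set k%:R%:E]).
  by apply: measurable_slab_count => //; exact: emeasurable_set1.
have PX k : P (X @^-1` [set k%:R%:E]) = poisson_prob r 0%N [set k].
  exact: slab_count_law.
exists (~` (X @^-1` [set 0%:R%:E] `|` X @^-1` [set 1%:R%:E])).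
  by apply: measurableC; apply: measurableU; exact: m1.
split=> [w /contrapT [X0|X1] q q' Uq Uq' qab qab' qB qB'|].
- have /eqP := X0; rewrite /X /point_count counting0P => /eqP e.
  have : (slab a b B `&` U w) q by [].
  by rewrite e.
- exact: (counting1_eq X1).
rewrite probability_setC; last by apply: measurableU; exact: m1.
rewrite measureU//; last first.
  apply/seteqP; split => // w [/= ->] /eqP; rewrite eqe; lra.
rewrite [X in (_ - (X + _))%E]PX [X in (_ - (_ + X))%E]PX.
rewrite poisson_prob0// poisson_prob1// -EFinD lee_fin.
have := expR_ge1Dx (- r); nra.
Qed.

Section Cells.
Variable (delta : R).
Hypothesis delta0 : 0 <= delta.

Definition cell (c : nat * 'rV[int]_d) :=
  slab (delta * c.1%:R) (delta * c.1.+1%:R) [:: c.2].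

Definition cell_bit c w : bool := point_count U (cell c) w != 0%:R%:E.

Let time_ge0 (j : nat) : 0 <= delta * j%:R. Proof. exact: mulr_ge0. Qed.

Lemma le_cell_time : {homo (fun j : nat => delta * j%:R) : i j / (i <= j)%N >-> i <= j}.
Proof. by move=> i j ij; rewrite ler_wpM2l// ler_nat. Qed.

Lemma cell_disjoint c e q : cell c q -> cell e q -> c = e.
Proof.
case: c e q => [i y] [j z] [s u] [/= si +] [/= sj +].
rewrite !inE => /eqP <- /eqP <-; congr (_, _).
suff lt_abs (k l : nat) : delta * k%:R < s <= delta * k.+1%:R ->
    delta * l%:R < s <= delta * l.+1%:R -> ~~ (k < l)%N.
  by case: (ltngtP i j) => // h; [have := lt_abs _ _ si sj|have := lt_abs _ _ sj si];
    rewrite h.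
move=> /andP[_ sk] /andP[ls _]; apply/negP => /le_cell_time kl.
by move: (lt_le_trans ls (le_trans sk kl)); rewrite ltxx.
Qed.

Lemma measurable_cell_bit c : measurable [set w | cell_bit c w].
Proof.
rewrite (_ : [set w | _] = point_count U (cell c) @^-1` (~` [set 0%:R%:E])).
  apply: measurable_slab_count => //; apply: measurableC.
  exact: emeasurable_set1.
by apply/seteqP; split => w /=; rewrite /cell_bit => /eqP.
Qed.

Lemma cell_bits_law cs v : uniq cs ->
  P [set w | forall c, c \in cs -> cell_bit c w = v c] =
  (\prod_(c <- cs) (if v c then 1 - expR (- delta) else 1 - (1 - expR (- delta))))%:E.
Proof.
move=> ucs; pose e (i : 'I_(size cs)) := tnth (in_tuple cs) i.
pose D i : set (\bar R) := if v (e i) then ~` [set 0%:R%:E] else [set 0%:R%:E].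
have mD i : measurable (D i).
  by rewrite /D; case: ifP => _; [apply: measurableC|]; exact: emeasurable_set1.
have e_inj : injective e by apply/tuple_uniqP.
have disj : trivIset setT (fun i => cell (e i)).
  by move=> i j _ _ [q [qi qj]]; apply: e_inj; exact: cell_disjoint qi qj.
have mcell i : spacetime_measurable (cell (e i)) by exact: slab_measurable.
have := ppp_independent UP mcell disj mD.
rewrite (_ : \bigcap_i _ = [set w | forall c, c \in cs -> cell_bit c w = v c]).
  move=> ->; rewrite big_tnth -prodEFin; apply: eq_bigr => i _ /=.
  have p0 : P (point_count U (cell (e i)) @^-1` [set 0%:R%:E]) = (expR (- delta))%:E.
    rewrite [LHS]slab_count_law//; last by rewrite ler_wpM2l// ler_nat.
    by rewrite mul1r -mulrBr -natrB// subSnn mulr1 poisson_prob0.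
  rewrite /D -/(e i); case: ifP => _; last by rewrite p0 subKr.
  rewrite -preimage_setC probability_setC; last first.
    exact: measurable_slab_count (emeasurable_set1 _).
  by rewrite [X in (_ - X)%E]p0.
have DE i w : D i (point_count U (cell (e i)) w) <-> cell_bit (e i) w = v (e i).
  rewrite /D /cell_bit; case: (v (e i)) => /=.
    by split => /eqP.
  by split => [->|/negbFE/eqP//]; rewrite eqxx.
apply/seteqP; split => w /=.
  by move=> h c /seq_tnthP[i ->]; apply/DE; exact: h.
by move=> h i _; apply/DE/h; exact: mem_tnth.
Qed.

End Cells.
End Slab.

(** * Variance of the discrete heights *)

Section DiscreteVariance.
Variables (R : realType) (d : nat) (disp : measure_display).
Variables (Omega : measurableType disp) (P : probability Omega R).
Variable (U : Omega -> set (R * 'rV[int]_d)).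
Hypothesis UP : poisson_point_process P U.
Variable (delta : R).
Hypothesis delta0 : 0 <= delta.

(** Variance at most [m * delta], uniformly in the finite region [B], and a mean
[e] in a bounded interval: what the passage to the limit uses. *)
Lemma height_second_moment m x B : uniq B ->
  let cs := [seq (j, y) | j <- iota 0 m, y <- B] in
  let H w : R := (height (neighbours d) (outcome (cell_bit U delta) cs w) m x)%:R in
  exists2 e, 0 <= e <= m%:R * delta & forall a,
    measurable_fun setT (fun w => ((H w - a) ^+ 2)%:E) /\
    (\int[P]_w ((H w - a) ^+ 2)%:E <= (m%:R * delta + (e - a) ^+ 2)%:E)%E.
Proof.
move=> uB cs H; set p := 1 - expR (- delta).
have pd : 0 <= p <= delta.
  rewrite /p subr_ge0 expR_le1 oppr_le0 delta0 /=.
  by have := expR_ge1Dx (- delta); lra.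
have p1 : 0 <= p <= 1.
  by case/andP: pd => -> _ /=; have := expR_gt0 (- delta); rewrite /p; lra.
have [p_ge0 p_le1] := andP p1; have [_ p_led] := andP pd.
have ucs : uniq cs.
  by apply: allpairs_uniq; rewrite ?iota_uniq// => -[? ?] [? ?].
have csm c : c \in cs -> (c.1 < m)%N.
  by case/allpairsP => -[j y] /= [+ _ ->]; rewrite mem_iota.
pose G v : R := (height (neighbours d) v m x)%:R.
exists (bernoulli_mean p cs G).
  apply/andP; split.
    by rewrite -(bernoulli_mean_cst p cs 0); apply: le_bernoulli_mean.
  apply: (@le_trans _ _
    (bernoulli_mean p cs (fun v => \sum_(j < m) (v (j : nat, x))%:R))).
    apply: le_bernoulli_mean => // v; rewrite -natr_sum ler_nat.
    exact: height_le_rings.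
  rewrite bernoulli_mean_sum [leRHS]mulr_natl -[m in leRHS]card_ord -sumr_const.
  by apply: ler_sum => j _; rewrite bernoulli_mean_bit//; case: ifP.
move=> a.
have law v : P (setT `&` [set w | forall c, c \in cs -> cell_bit U delta c w = v c]) =
    (1 * \prod_(c <- cs) (if v c then p else 1 - p))%:E.
  by rewrite setTI mul1r cell_bits_law.
have G0 v : 0 <= (G v - a) ^+ 2 by exact: sqr_ge0.
have [mG iG] := integral_outcome (measurable_cell_bit UP delta0) ucs measurableT G0 law.
split; first exact: mG.
rewrite [leLHS]iG lee_fin mul1r bernoulli_mean_sqr lerD2r.
apply: (le_trans (efron_stein p_ge0 p_le1 G ucs)).
rewrite mulrC; apply: ler_pM => //.
  rewrite -(bernoulli_mean_cst p cs 0); apply: le_bernoulli_mean => // v.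
  by apply: sumr_ge0 => c _; rewrite mulr_ge0 ?sqr_ge0.
rewrite -[leRHS](bernoulli_mean_cst p cs); apply: le_bernoulli_mean => // v.
exact: height_energy.
Qed.
End DiscreteVariance.

(** * Passage to the limit *)

Section Variance.
Variables (R : realType) (disp : measure_display).
Variables (Omega : measurableType disp) (P : probability Omega R).

Lemma variance_le_second_moment (X : Omega -> R) (a b : R) :
  measurable_fun setT X -> (\int[P]_w ((X w - a) ^+ 2)%:E <= b%:E)%E ->
  ('V_P[X] <= b%:E)%E.
Proof.
move=> mX Xb; pose Y w := X w - a.
have mY : measurable_fun setT Y by exact: measurable_funB.
have Y2 : Y \in Lfun P 2%:E.
  rewrite inE; apply/andP; split; rewrite inE //=.
  rewrite /finite_norm unlock /Lnorm; apply: poweR_lty.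
  under eq_integral => w _ do
    rewrite /= powR_mulrn// real_normK ?num_real//.
  exact: le_lt_trans Xb (ltry _).
have -> : X = (Y \+ cst a)%R by apply/funext => w; rewrite /Y /= subrK.
rewrite varianceD_cst_r// varianceE//; apply: le_trans Xb.
have Y1 : ('E_P[Y] \is a fin_num)%E.
  by apply: expectation_fin_num; apply: Lfun_subset12; rewrite ?fin_num_measure.
have -> : (\int[P]_w ((X w - a) ^+ 2)%:E = 'E_P[Y ^+ 2])%E by rewrite unlock.
by rewrite -(fineK Y1) leeBlDr// leeDl// -EFin_expe lee_fin sqr_ge0.
Qed.

Lemma limn_einf_le (u : (\bar R)^nat) b :
  (forall n, exists2 k, (n <= k)%N & (u k <= b)%E) -> (limn_einf u <= b)%E.
Proof.
move=> ub; rewrite limn_einf_lim; apply: lime_le; first exact: is_cvg_einfs.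
apply: nearW => n; have [k nk ukb] := ub n.
by apply: le_trans ukb; apply: ereal_inf_lbound; exists k.
Qed.

(** The variance is at most the second moment about any [a], and taking for [a]
a cluster point of the [e k] makes [(e k - a) ^+ 2] small for infinitely many
[k], which is enough for the inferior limit in Fatou's lemma. *)
Lemma fatou_variance_le (H : nat -> Omega -> R) (F : Omega -> R)
    (e : nat -> R) (b M : R) :
  measurable_fun setT F ->
  (forall k a, measurable_fun setT (fun w => ((H k w - a) ^+ 2)%:E)) ->
  (forall k, 0 <= e k <= M) ->
  (forall k a, (\int[P]_w ((H k w - a) ^+ 2)%:E <= (b + (e k - a) ^+ 2)%:E)%E) ->
  {ae P, forall w, \forall k \near \oo, H k w = F w} ->
  ('V_P[F] <= b%:E)%E.
Proof.
move=> mF mH eM Hb HF.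
have [a aP] : exists a, forall eps N, 0 < eps ->
    exists2 k, (N <= k)%N & `|e k - a| < eps.
  have [|a [_ aP]] := @segment_compact R 0 M (e @ \oo) _.
    by exists 0%N => // k _; rewrite /= in_itv /= eM.
  exists a => eps N eps0.
  have tail : (e @ \oo) (e @` [set k | (N <= k)%N]).
    by exists N => // k /= Nk; exists k.
  have [_ [[k /= Nk <-] ek]] := aP _ _ tail (nbhsx_ballx a eps eps0).
  by exists k => //; rewrite distrC.
apply: (variance_le_second_moment (a := a)) => //.
pose u k w := ((H k w - a) ^+ 2)%:E.
have ulim : {ae P, forall w, setT w -> ((F w - a) ^+ 2)%:E = limn_einf (u ^~ w)}.
  apply: filterS HF => w Hw _; apply/esym; apply: (cvg_limn_einf_sup _).1.
  apply: cvg_near_cst; apply: filterS Hw => k; rewrite /u => -> //.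
have mu_ : measurable_fun setT (fun w => limn_einf (u ^~ w)).
  apply: measurableT_comp => //; apply: measurable_fun_limn_esup => k.
  by apply: measurableT_comp => //; exact: mH.
have u0 k w : (0 <= u k w)%E by rewrite lee_fin sqr_ge0.
rewrite (ge0_ae_eq_integral measurableT _ mu_ _ _ ulim); last 3 first.
- by apply/measurable_EFinP; apply: measurable_funX; exact: measurable_funB.
- by move=> w _; rewrite lee_fin sqr_ge0.
- move=> w _; rewrite limn_einf_lim; apply: lime_ge; first exact: is_cvg_einfs.
  apply: nearW => n; apply: le_ereal_inf_tmp => _ [k _ <-]; exact: u0.
apply: le_trans (fatou P measurableT (fun k => mH k a) (fun k w _ => u0 k w)) _.
apply/lee_addgt0Pr => eps eps0; apply: limn_einf_le => N.
(* [eps' ^+ 2 <= eps] *)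
pose eps' := Num.min eps 1.
have eps'0 : 0 < eps' by rewrite lt_min eps0 ltr01.
have [k Nk ek] := aP eps' N eps'0; exists k => //.
apply: le_trans (Hb k a) _; rewrite -EFinD lee_fin lerD2l.
rewrite -real_normK ?num_real// expr2.
have : eps' <= eps by rewrite /eps' ge_min lexx.
have : eps' <= 1 by rewrite /eps' ge_min lexx orbT.
have := normr_ge0 (e k - a); nra.
Qed.

End Variance.

(** * Separation of the rings by a dyadic mesh *)

Section Mesh.
Variables (R : realType) (d : nat) (disp : measure_display).
Variables (Omega : measurableType disp) (P : probability Omega R).
Variable (U : Omega -> set (R * 'rV[int]_d)).
Hypothesis UP : poisson_point_process P U.
Variable t : R.
Hypothesis t0 : 0 <= t.

Definition mesh k : R := t / (2 ^ k)%:R.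

Lemma mesh_ge0 k : 0 <= mesh k. Proof. exact: divr_ge0. Qed.

Lemma meshM k : mesh k * (2 ^ k)%:R = t.
Proof. by rewrite /mesh divfK// pnatr_eq0 -lt0n expn_gt0. Qed.

Lemma meshS k : mesh k = 2 * mesh k.+1.
Proof.
rewrite /mesh expnS natrM invfM mulrCA [2 * _]mulrA [2 * _^-1]mulfV ?mul1r ?pnatr_eq0//.
Qed.

Definition mesh_sparse (u : set (R * 'rV[int]_d)) B k := forall j, (j < 2 ^ k)%N ->
  sparse u B (mesh k * j%:R) (mesh k * j.+1%:R).

(** The slots are dyadic so that those of level [k + 1] refine those of level
[k], and sparsity at one level gives it at all later ones. *)
Lemma mesh_sparseS u B k l : (k <= l)%N -> mesh_sparse u B k -> mesh_sparse u B l.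
Proof.
move=> kl; rewrite -(subnKC kl); elim: (l - k)%N => [|i IH]; rewrite ?addn0//.
move=> /IH; rewrite addnS => sp j jl.
have j2 : (j./2 < 2 ^ (k + i))%N.
  by rewrite ltn_half_double -mul2n -expnS.
have meshE n : mesh (k + i) * n%:R = mesh (k + i).+1 * (2 * n)%:R.
  by rewrite meshS natrM; ring.
apply: sparseS (sp _ j2) => //; rewrite meshE ler_wpM2l ?mesh_ge0// ler_nat; lia.
Qed.

Lemma mesh_sparse_prob B k : uniq B -> exists2 E, measurable E &
  (forall w, ~ E w -> mesh_sparse (U w) B k) /\
  (P E <= (((size B)%:R * t) ^+ 2 / (2 ^ k)%:R)%:E)%E.
Proof.
move=> uB; set b : R := (size B)%:R.
have /choice[E EP] : forall j : nat, exists E, measurable E /\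
    (forall w, ~ E w -> sparse (U w) B (mesh k * j%:R) (mesh k * j.+1%:R)) /\
    (P E <= ((b * mesh k) ^+ 2)%:E)%E.
  move=> j; have [||E mE [Esp PE]] := @slab_multiple_prob _ _ _ _ _ _ UP
    (mesh k * j%:R) (mesh k * j.+1%:R) B _ _ uB.
  - by rewrite mulr_ge0 ?mesh_ge0.
  - exact: le_cell_time (mesh_ge0 k) _ _ (leqnSn j).
  exists E; split=> //; split=> //.
  by rewrite -mulrBr -natrB// subSnn mulr1 in PE.
have mE j : measurable (E j) by have [] := EP j.
exists (\big[setU/set0]_(j < 2 ^ k) E j); first exact: bigsetU_measurable.
split=> [w nE j jk|].
  have [_ [+ _]] := EP j; apply => Ej; apply: nE.
  by rewrite -bigcup_mkord; exists j.
apply: le_trans (Boole_inequality P (fun j _ => mE j)) _.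
apply: (@le_trans _ _ (\sum_(j < 2 ^ k) ((b * mesh k) ^+ 2)%:E)%E).
  by apply: lee_sum => j _; have [_ []] := EP j.
rewrite sumEFin sumr_const card_ord lee_fin -mulr_natr.
rewrite -(meshM k) !exprMn le_eqVlt; apply/orP; left; apply/eqP.
field. by rewrite pnatr_eq0 -lt0n expn_gt0.
Qed.

(** The [2 ^ k] slots carry two rings with total probability of order [2 ^ - k],
so the set of outcomes that are sparse at no level is negligible.  This also
excludes simultaneous rings and accumulation of rings inside [B K]. *)
Lemma ae_mesh_sparse (B : nat -> seq 'rV[int]_d) :
  {ae P, forall w, forall K, exists k, mesh_sparse (U w) (B K) k}.
Proof.
suff H K : {ae P, forall w, exists k, mesh_sparse (U w) (B K) k}.
  have := negligible_bigcup H; apply: negligibleS => w /=.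
  by move/existsNP => [K hK]; exists K.
have /choice[E EP] : forall k, exists E, measurable E /\
    (forall w, ~ E w -> mesh_sparse (U w) (undup (B K)) k) /\
    (P E <= (((size (undup (B K)))%:R * t) ^+ 2 / (2 ^ k)%:R)%:E)%E.
  by move=> k; have [E mE [? ?]] := mesh_sparse_prob k (undup_uniq (B K)); exists E.
have mE k : measurable (E k) by have [] := EP k.
exists (\bigcap_k E k); split; first exact: bigcap_measurable.
  apply/eqP; rewrite eq_le measure_ge0 andbT.
  apply/lee_addgt0Pr => eps eps0; rewrite add0e.
  set c : R := ((size (undup (B K)))%:R * t) ^+ 2.
  have c0 : 0 <= c by exact: sqr_ge0.
  pose k := Num.truncn (c / eps).
  have ck : c / (2 ^ k)%:R <= eps.
    rewrite ler_pdivrMr ?ltr0n ?expn_gt0// mulrC -ler_pdivrMr//.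
    apply/ltW/(lt_le_trans (truncnS_gt _)); rewrite ler_nat.
    exact: ltn_expl.
  apply: le_trans (_ : (P (E k) <= _)%E).
    apply: le_measure; rewrite ?inE//; first exact: bigcap_measurable.
    exact: bigcap_inf.
  by have [_ [_ /le_trans]] := EP k; apply; rewrite lee_fin.
move=> w /= /forallNP h k _; apply: contrapT => nE; apply: (h k).
have [_ [/(_ w nE) sp _]] := EP k => j jk; apply: sparseS (sp j jk) => // y.
by rewrite mem_undup.
Qed.

End Mesh.

(** * The variance bound *)

Lemma cell_bitE (R : realType) d disp (Omega : measurableType disp)
    (U : Omega -> set (R * 'rV[int]_d)) delta j y w :
  cell_bit U delta (j, y) w =
    `[< rings (U w) (delta * j%:R) (delta * j.+1%:R) y >].
Proof.
rewrite /cell_bit /point_count counting0P; apply/idP/asboolP => [/set0P[[s z] []]|].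
  by rewrite /cell /slab /= inE => -[sj /eqP ->] Us; exists s.
case=> r rj Ur; apply/set0P; exists (r, y); split=> //.
by split=> //=; rewrite inE.
Qed.

Theorem theorem4p3 (R : realType) (d : nat) (d_ge1 : (1 <= d)%N)
    (disp : measure_display) (Omega : measurableType disp)
    (P : probability Omega R) (U : Omega -> set (R * 'rV[int]_d))
    (f : R -> 'rV[int]_d -> Omega -> int) :
  poisson_point_process P U ->
  rsos_model P U (fun _ => 0) f ->
  forall (t : R) (x : 'rV[int]_d), 0 <= t ->
    ('V_P[(fun w => (f t x w)%:~R)] <= t%:E)%E.
Proof.
move=> UP [mf fpath] t x t0.
pose B k := undup (nbhd k x).
pose cs k := [seq (j, y) | j <- iota 0 (2 ^ k), y <- B k].
pose H k w : R :=
  (height (neighbours d) (outcome (cell_bit U (mesh t k)) (cs k) w) (2 ^ k) x)%:R.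
have /choice[e eP] : forall k, exists e, 0 <= e <= t /\ forall a,
    measurable_fun setT (fun w => ((H k w - a) ^+ 2)%:E) /\
    (\int[P]_w ((H k w - a) ^+ 2)%:E <= (t + (e - a) ^+ 2)%:E)%E.
  move=> k; have := height_second_moment UP (mesh_ge0 t0 k) (2 ^ k) x
    (undup_uniq (nbhd k x)).
  by rewrite mulrC meshM => -[e e_ge0 ea]; exists e.
apply: (@fatou_variance_le _ _ _ P H _ e t t).
- exact: mf.
- by move=> k a; have [_ /(_ a)[]] := eP k.
- by move=> k; have [] := eP k.
- by move=> k a; have [_ /(_ a)[]] := eP k.
have sparse_ae := ae_mesh_sparse UP t0 (fun K => nbhd K.+2 x).
apply: filterS2 fpath sparse_ae => w fw spw.
(* The region needed is random: its radius is the height itself. *)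
pose K := `|f t x w|%N.
have [k0 spk] := spw K.
exists (maxn k0 K.+2) => // k /=; rewrite geq_max => /andP[k0k Kk].
rewrite /H pmulrn; congr (_%:~R).
rewrite (@height_path _ _ (U w) (fun s y => f s y w)
  (fun j => mesh t k * j%:R) _ _ K) => //.
- by rewrite meshM.
- by rewrite mulr0.
- exact: le_cell_time (mesh_ge0 t0 k).
- exact: mesh_sparseS k0k spk.
- move=> j y jk yK; rewrite /outcome cell_bitE andb_idl// => _.
  apply: allpairs_f; first by rewrite mem_iota.
  by rewrite mem_undup; exact: sub_nbhd yK.
- by rewrite meshM /K; lia.
Qed.
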